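(* For every real $\phi$ with $0 \le \phi < \pi/2$, the algorithm $A_{SS}^{\phi}:\mathbb{R}^2\to\mathbb{R}^2$ (defined in the context) is a gathering algorithm for two oblivious robots with $\phi$-static compasses under the asynchronous model; that is, for every initial configuration $C(0)$, every fair asynchronous execution of $A_{SS}^{\phi}$ by two robots with $\phi$-static compasses starting from $C(0)$ is a gathering execution.
   Context: Robots. Two anonymous oblivious robots $r_0,r_1$ are points in $\mathbb{R}^2$, with position $\mathbf r_i(t)\in\mathbb{R}^2$ of $r_i$ at time $t$ in a global coordinate system $Z$. The configuration at time $t$ is $C(t)=(\mathbf r_0(t),\mathbf r_1(t))$. At time $t$ robot $r_i$ has a local coordinate system $Z_{(i,t)}$ given by $$Z_{(i,t)}(\mathbf p)^T = sc_i(t)\begin{pmatrix}\cos\phi_i(t)&\sin\phi_i(t)\\-\sin\phi_i(t)&\cos\phi_i(t)\end{pmatrix}(\mathbf p-\mathbf r_i(t))^T,$$ where the scaling ratio $sc_i(t)\in(0,\infty)$ and the compass deviation $\phi_i(t)\in(-\pi,\pi]$ are chosen by an adversary. (The scaling ratio may change from cycle to cycle.) Compasses. The compasses are $\phi$-compasses if $|\phi_i(t)|\le\phi$ for $i\in\{0,1\}$ and all $t\in\mathbb{N}$ (where $0\in\mathbb N$). They are $\phi$-static if in addition each $\phi_i(t)=\phi_i$ is constant in $t$. Algorithm and look-compute-move cycle. An algorithm is a total function $\psi:\mathbb{R}^2\to\mathbb{R}^2$, used by both robots. A robot $r_i$ activated at time $t\in\mathbb N$ observes the other robot $r_{1-i}$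 instantaneously at time $t$, at local coordinates $\mathbf p=Z_{(i,t)}(\mathbf r_{1-i}(t))$ (the other robot may be in the middle of a move at that time), and then moves in a straight line from $\mathbf r_i(t)$ toward the point whose coordinates in the coordinate system $Z_{(i,t)}$ fixed at time $t$ are $\psi(\mathbf p)$ (its destination). The adversary may stop the move before the destination is reached, but the robot either reaches its destination or travels a distance at least $\delta$ (measured in $Z$) during the cycle, where $\delta>0$ is a fixed constant. Asynchronous execution. The adversary chooses the activation times (start times of cycles) of each robot; the set of times at which at least one robot is activated is $\mathbb N$. No assumption is made on the duration of a cycle: if $t<t'$ are consecutive activation times of $r_i$, then during $[t,t']$ robot $r_i$ progresses monotonically (with arbitrary, possibly variable, adversarially chosen finite speed, including arbitrary pauses) along the segment from $\mathbf r_i(t)$ toward its destination computed at $t$, and by time $t'$ it has reached the destination or travelled at least $\delta$. Before its first activation a robot does not move. An execution is the resulting infinite sequence $C(0),C(1),\dots$; it is required to be fair: each robot is activated infinitely many times. Gathering. An execution is a gathering execution if there are $\mathbf p\in\mathbb{R}^2$ and $f\in\mathbb N$ with $C(t)=(\mathbf p,\mathbf p)$ for all $t\ge f$. An algorithm is a gathering algorithm (it solves the gathering problem) if for every initial configuration $C(0)$, every execution starting from $C(0)$ is a gathering execution. Algorithm $A_{SS}^{\phi}$. For $\mathbf p\ne\mathbf 0$, $\arg(\mathbf p)$ is the polar angle $\omega\in[0,2\pi)$ with $\mathbf p=|\mathbf p|(\cos\omega,\sin\omega)$; angles are taken modulo $2\pi$ (so $\arg=2\pi$ means $\arg=0$).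 (Gathered) If $\mathbf p=\mathbf 0$ then $A_{SS}^{\phi}(\mathbf p)=\mathbf 0$. (Approach) If $0<\arg(\mathbf p)\le\pi$ then $A_{SS}^{\phi}(\mathbf p)=\mathbf p$. (Rotate) If $\pi<\arg(\mathbf p)\le 3\pi/2+\phi$ then $A_{SS}^{\phi}(\mathbf p)=(-|\mathbf p|,0)$. (Wait) If $3\pi/2+\phi<\arg(\mathbf p)\le 2\pi$ then $A_{SS}^{\phi}(\mathbf p)=\mathbf 0$. *)

(* Defs.v *)
From Stdlib Require Import Reals Lra ClassicalEpsilon.
Local Open Scope R_scope.

Definition point : Type := (R * R)%type.

Definition norm (p : point) : R := sqrt (fst p ^ 2 + snd p ^ 2).

Definition dist (p q : point) : R := norm (fst q - fst p, snd q - snd p).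

Definition toward (a b : point) (l : R) : point :=
  (fst a + l * (fst b - fst a), snd a + l * (snd b - snd a)).

Definition is_arg (p : point) (w : R) : Prop :=
  0 <= w < 2 * PI /\ p = (norm p * cos w, norm p * sin w).

(** Only meaningful for [p <> (0, 0)]; see [arg_spec] and [arg_unique]. *)
Definition arg (p : point) : R := epsilon (inhabits 0) (is_arg p).

Lemma norm_pos (p : point) : p <> (0, 0) -> 0 < norm p.
Proof.
destruct p as [x y]; unfold norm; simpl; intros Hp; apply sqrt_lt_R0.
destruct (Req_dec x 0) as [Hx|Hx]; [destruct (Req_dec y 0) as [Hy|Hy]|].
- now subst.
- nra.
- nra.
Qed.

Lemma arg_spec (p : point) : p <> (0, 0) -> is_arg p (arg p).
Proof.
intros Hp; unfold arg; apply epsilon_spec.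
pose proof (norm_pos p Hp) as Hn.
assert (Hsq : norm p * norm p = fst p ^ 2 + snd p ^ 2)
  by (unfold norm; apply sqrt_sqrt; nra).
destruct p as [x y]; simpl in Hsq; set (n := norm (x, y)) in *.
set (u := x / n); set (v := y / n).
assert (Hx : x = n * u) by (unfold u; field; lra).
assert (Hy : y = n * v) by (unfold v; field; lra).
assert (Huv : u * u + v * v = 1).
{ apply Rmult_eq_reg_l with (n * n); [rewrite Hx, Hy in Hsq; nra | nra]. }
assert (Hu : -1 <= u <= 1) by nra.
pose proof (acos_bound u) as Ha.
pose proof (cos_acos u Hu) as Hc.
pose proof (sin_acos u Hu) as Hs.
replace (1 - u²) with (v²) in Hs by (unfold Rsqr; lra).
rewrite sqrt_Rsqr_abs in Hs.
pose proof PI_RGT_0.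
destruct (Rle_lt_dec 0 v) as [Hv|Hv].
- exists (acos u); split; [lra|]; fold n.
  rewrite Hc, Hs, Rabs_right by lra; now rewrite <- Hx, <- Hy.
- exists (2 * PI - acos u); rewrite Rabs_left in Hs by lra; split.
  + assert (acos u <> 0) by (intros E; rewrite E, sin_0 in Hs; lra); lra.
  + fold n; rewrite cos_minus, sin_minus, cos_2PI, sin_2PI, Hc, Hs.
    f_equal; lra.
Qed.

Lemma arg_unique (p : point) (w w' : R) :
  p <> (0, 0) -> is_arg p w -> is_arg p w' -> w = w'.
Proof.
intros Hp [Hw E] [Hw' E']; pose proof (norm_pos p Hp) as Hn.
rewrite E in E' at 1; injection E' as Ec Es.
apply Rmult_eq_reg_l in Ec; [|lra]; apply Rmult_eq_reg_l in Es; [|lra].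
pose proof (sin2_cos2 w') as H1; unfold Rsqr in H1.
assert (H2 : cos (2 * ((w - w') / 2)) = 1).
{ replace (2 * ((w - w') / 2)) with (w - w') by lra.
  rewrite cos_minus, Ec, Es; lra. }
rewrite cos_2a_sin in H2.
assert (H3 : sin ((w - w') / 2) = 0) by nra.
destruct (Rtotal_order w w') as [L|[L|L]]; trivial; exfalso.
- pose proof (sin_gt_0 (- ((w - w') / 2)) ltac:(lra) ltac:(lra)) as H4.
  rewrite sin_neg in H4; lra.
- pose proof (sin_gt_0 ((w - w') / 2) ltac:(lra) ltac:(lra)); lra.
Qed.

(** [local_coord c s a] is the coordinate system with origin [c], scaling ratio
    [s] and compass deviation [a], as a map from global to local coordinates. *)
Definition local_coord (c : point) (s a : R) (p : point) : point :=
  let x := fst p - fst c in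
  let y := snd p - snd c in
  (s * (cos a * x + sin a * y), s * (- sin a * x + cos a * y)).

Definition algorithm : Type := point -> point.

(** The last branch is [3 * PI / 2 + phi < arg p < 2 * PI] or [arg p = 0];
    the latter stands for the angle [2 * PI]. *)
Definition A_SS (phi : R) : algorithm := fun p =>
  if excluded_middle_informative (p = (0, 0)) then (0, 0)
  else if excluded_middle_informative (0 < arg p <= PI) then p
  else if excluded_middle_informative (PI < arg p <= 3 * PI / 2 + phi)
  then (- norm p, 0)
  else (0, 0).

(** The two robots are indexed by [bool]; [negb i] is the other robot.
    Positions are given in continuous time (only times [>= 0] matter), whereas
    activations, and hence observations, take place at integer times. *)
Record run : Type := Run {
  pos : bool -> R -> point;
  activated : bool -> nat -> Prop;
  scale : bool -> nat -> R;
  deviation : bool -> nat -> R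
}.

Definition position (e : run) (i : bool) (t : nat) : point := pos e i (INR t).

Definition config (e : run) (t : nat) : point * point :=
  (position e false t, position e true t).

Definition frame (e : run) (i : bool) (t : nat) : point -> point :=
  local_coord (position e i t) (scale e i t) (deviation e i t).

Definition consecutive_activations (e : run) (i : bool) (t t' : nat) : Prop :=
  (t < t')%nat /\ activated e i t /\ activated e i t' /\
  forall u : nat, (t < u < t')%nat -> ~ activated e i u.

(** [l s] is the fraction of the way to the destination [q] covered at time
    [s]. Finite speed amounts to continuity of [l]; what [l] does outside
    [[t, t']] is irrelevant. *)
Definition moves_toward (e : run) (i : bool) (t t' : nat) (q : point) : Prop :=
  exists l : R -> R,
    continuity l /\
    l (INR t) = 0 /\
    (forall s s' : R, INR t <= s <= s' /\ s' <= INR t' -> l s <= l s') /\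
    (forall s : R, INR t <= s <= INR t' ->
       0 <= l s <= 1 /\ pos e i s = toward (position e i t) q (l s)).

Record execution (psi : algorithm) (delta : R) (e : run) : Prop := {
  scale_pos : forall i t, 0 < scale e i t;
  deviation_range : forall i t, - PI < deviation e i t <= PI;
  activation_times : forall t, exists i, activated e i t;
  fair : forall i n, exists t, (n <= t)%nat /\ activated e i t;
  initially_idle : forall i (s : R), 0 <= s ->
    (forall t, activated e i t -> s <= INR t) -> pos e i s = pos e i 0;
  cycle : forall i t t', consecutive_activations e i t t' ->
    exists q : point,
      frame e i t q = psi (frame e i t (position e (negb i) t)) /\
      moves_toward e i t t' q /\
      (position e i t' = q \/ delta <= dist (position e i t) (position e i t'))
}.

Definition phi_compasses (phi : R) (e : run) : Prop :=
  forall i t, Rabs (deviation e i t) <= phi.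

Definition static_compasses (phi : R) (e : run) : Prop :=
  phi_compasses phi e /\
  exists a : bool -> R, forall i t, deviation e i t = a i.

Definition gathering_execution (e : run) : Prop :=
  exists (p : point) (f : nat), forall t, (f <= t)%nat -> config e t = (p, p).

Definition gathering_algorithm_static (phi delta : R) (psi : algorithm) : Prop :=
  forall (C0 : point * point) (e : run),
    execution psi delta e -> static_compasses phi e -> config e 0 = C0 ->
    gathering_execution e.

(* Main.v *)
(** An activated robot approaches the other one exactly when the latter is not
    behind it in the lexicographic order on (north, west) of its own compass;
    otherwise it waits or moves to its own west, getting further ahead in that
    order. Call [j] a leader when the other robot and its pending destination
    are behind [j] in the order of [j], and [j] is only moving to its west.

    If the follower of a leader always approaches, the robots gather: in the
    frame of the leader the follower rises towards the line of the leader, a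
    destination once reached is on that line, and a leader that rotates infinitely
    often stays within a bounded multiple of the vertical gap of the follower.

    When the deviation of [j] is the smaller one, its being leader is an
    invariant. As long as the follower does not approach, the leader keeps
    rotating and rises in the frame of the follower, hence the follower
    approaches at some time, and from then on always. When the robot with the
    larger deviation leads, either its follower always approaches or, from the
    first time that it does not, the roles are exchanged for good. The remaining
    case is that both robots initially approach; then they stay on a line and
    either meet there, or pass each other and one of them becomes a leader. *)

From Stdlib Require Import Reals Lra Lia Wf_nat ClassicalEpsilon.
Require Import Defs.
Local Open Scope R_scope.

(** * Directions and the order of a compass *)

Definition east (a : R) (p : point) : R := cos a * fst p + sin a * snd p.

Definition north (a : R) (p : point) : R := - sin a * fst p + cos a * snd p.

Definition west_move (a : R) (p : point) (m : R) : point :=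
  (fst p - m * cos a, snd p - m * sin a).

Definition west_of (a : R) (p q : point) : Prop :=
  exists m, 0 <= m /\ q = west_move a p m.

(** A robot with deviation [a] at [p] approaches a robot at [q] exactly when
    [ahead a p q] (see [A_SS_global]). As the cone of angles [(0, PI]] and its
    opposite partition the nonzero vectors, [ahead a] is a total order. *)
Definition ahead (a : R) (p q : point) : Prop :=
  north a p < north a q \/ (north a p = north a q /\ east a q <= east a p).

Lemma cos_sin_sqr (a : R) : cos a * cos a + sin a * sin a = 1.
Proof. pose proof (sin2_cos2 a) as H; unfold Rsqr in H; lra. Qed.

Lemma east_north_inj (a : R) (p q : point) :
  east a p = east a q -> north a p = north a q -> p = q.
Proof.
destruct p as [x y], q as [x' y']; unfold east, north; simpl; intros He Hn.
pose proof (cos_sin_sqr a) as H1.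
set (c := cos a) in *; set (s := sin a) in *.
f_equal.
- replace x with ((c * c + s * s) * x) by (rewrite H1; ring).
  replace x' with ((c * c + s * s) * x') by (rewrite H1; ring).
  transitivity (c * (c * x + s * y) - s * (- s * x + c * y)); [ring|].
  rewrite He, Hn; ring.
- replace y with ((c * c + s * s) * y) by (rewrite H1; ring).
  replace y' with ((c * c + s * s) * y') by (rewrite H1; ring).
  transitivity (s * (c * x + s * y) + c * (- s * x + c * y)); [ring|].
  rewrite He, Hn; ring.
Qed.

Lemma east_toward (a : R) (p q : point) (l : R) :
  east a (toward p q l) = east a p + l * (east a q - east a p).
Proof. unfold east, toward; simpl; ring. Qed.

Lemma north_toward (a : R) (p q : point) (l : R) :
  north a (toward p q l) = north a p + l * (north a q - north a p).
Proof. unfold north, toward; simpl; ring. Qed.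

Lemma east_west_move (a b : R) (p : point) (m : R) :
  east b (west_move a p m) = east b p - m * cos (a - b).
Proof. rewrite cos_minus; unfold east, west_move; simpl; ring. Qed.

Lemma north_west_move (a b : R) (p : point) (m : R) :
  north b (west_move a p m) = north b p + m * sin (b - a).
Proof. rewrite sin_minus; unfold north, west_move; simpl; ring. Qed.

Lemma east_west_move_same (a : R) (p : point) (m : R) :
  east a (west_move a p m) = east a p - m.
Proof. rewrite east_west_move, Rminus_diag, cos_0; ring. Qed.

Lemma north_west_move_same (a : R) (p : point) (m : R) :
  north a (west_move a p m) = north a p.
Proof. rewrite north_west_move, Rminus_diag, sin_0; ring. Qed.

Lemma toward_0 (p q : point) : toward p q 0 = p.
Proof. destruct p; unfold toward; simpl; f_equal; ring. Qed.

Lemma toward_1 (p q : point) : toward p q 1 = q.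
Proof. destruct q; unfold toward; simpl; f_equal; ring. Qed.

Lemma dist_east_north (a : R) (p q : point) :
  dist p q = sqrt ((east a q - east a p) ^ 2 + (north a q - north a p) ^ 2).
Proof.
unfold dist, norm; simpl fst; simpl snd; f_equal; unfold east, north.
pose proof (cos_sin_sqr a) as H1.
transitivity ((cos a * cos a + sin a * sin a)
  * ((fst q - fst p) ^ 2 + (snd q - snd p) ^ 2)); [rewrite H1; ring | ring].
Qed.

Lemma dist_le_east_north (a : R) (p q : point) :
  dist p q <= Rabs (east a q - east a p) + Rabs (north a q - north a p).
Proof.
rewrite (dist_east_north a).
set (x := east a q - east a p); set (y := north a q - north a p).
pose proof (Rabs_pos x) as Hx; pose proof (Rabs_pos y) as Hy.
pose proof (Rmult_le_pos _ _ Hx Hy).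
rewrite <- (sqrt_Rsqr (Rabs x + Rabs y)) by lra.
apply sqrt_le_1_alt; rewrite <- (pow2_abs x), <- (pow2_abs y); unfold Rsqr; lra.
Qed.

Lemma north_le_dist (a : R) (p q : point) :
  Rabs (north a q - north a p) <= dist p q.
Proof.
rewrite (dist_east_north a), <- sqrt_Rsqr_abs; apply sqrt_le_1_alt.
pose proof (pow2_ge_0 (east a q - east a p)); unfold Rsqr; lra.
Qed.

Lemma dist_nonneg (p q : point) : 0 <= dist p q.
Proof. apply sqrt_pos. Qed.

Lemma ahead_refl (a : R) (p : point) : ahead a p p.
Proof. right; lra. Qed.

Lemma ahead_trans (a : R) (q p r : point) :
  ahead a p q -> ahead a q r -> ahead a p r.
Proof. unfold ahead; lra. Qed.

Lemma ahead_antisym (a : R) (p q : point) : ahead a p q -> ahead a q p -> p = q.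
Proof. intros H H'; apply (east_north_inj a); unfold ahead in *; lra. Qed.

Lemma not_ahead (a : R) (p q : point) : ~ ahead a p q -> ahead a q p.
Proof.
unfold ahead; intros H.
destruct (Rtotal_order (north a p) (north a q)) as [L|[L|L]]; [tauto| |tauto].
destruct (Rle_lt_dec (east a p) (east a q)); [right; lra|].
exfalso; apply H; right; lra.
Qed.

(** An open half-plane together with a closed ray of its border is convex. The extreme values of [l]
    are split off because a strict inequality needs a positive weight. *)
Lemma ahead_toward (a : R) (p q q' : point) (l : R) : 0 <= l <= 1 ->
  ahead a p q -> ahead a p q' -> ahead a p (toward q q' l).
Proof.
intros Hl [H|[H H0]] [H'|[H' H0']]; unfold ahead;
  rewrite north_toward, east_toward.
- left; destruct (proj2 Hl) as [L| ->]; nra.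
- destruct (proj2 Hl) as [L| ->]; [left; nra | right; split; nra].
- destruct (proj1 Hl) as [L| <-]; [left; nra | right; split; nra].
- right; split; [rewrite <- H, <- H'; ring | nra].
Qed.

Lemma toward_ahead (a : R) (p q q' : point) (l : R) : 0 <= l <= 1 ->
  ahead a q p -> ahead a q' p -> ahead a (toward q q' l) p.
Proof.
intros Hl [H|[H H0]] [H'|[H' H0']]; unfold ahead;
  rewrite north_toward, east_toward.
- left; destruct (proj2 Hl) as [L| ->]; nra.
- destruct (proj2 Hl) as [L| ->]; [left; nra | right; split; nra].
- destruct (proj1 Hl) as [L| <-]; [left; nra | right; split; nra].
- right; split; [rewrite H, H'; ring | nra].
Qed.

Lemma ahead_toward_toward (a : R) (p q : point) (s s' : R) :
  ahead a p q -> s <= s' -> ahead a (toward p q s) (toward p q s').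
Proof.
intros [H|[H H0]] Hs; unfold ahead; rewrite !north_toward, !east_toward.
- destruct Hs as [Hs| ->]; [left; nra | right; lra].
- right; rewrite H; split; nra.
Qed.

Lemma west_of_refl (a : R) (p : point) : west_of a p p.
Proof.
exists 0; split; [lra|]; destruct p; unfold west_move; simpl; f_equal; ring.
Qed.

Lemma west_of_east_north (a : R) (p q : point) :
  north a q = north a p -> east a q <= east a p -> west_of a p q.
Proof.
intros Hn He; exists (east a p - east a q); split; [lra|].
apply (east_north_inj a).
- rewrite east_west_move_same; ring.
- now rewrite north_west_move_same.
Qed.

Lemma west_of_east (a : R) (p q : point) :
  west_of a p q -> north a q = north a p /\ east a q <= east a p.
Proof.
intros [m [Hm ->]]; rewrite north_west_move_same, east_west_move_same; lra.
Qed.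

Lemma west_of_toward (a : R) (p q : point) (l : R) : 0 <= l <= 1 ->
  west_of a p q -> west_of a p (toward p q l) /\ west_of a (toward p q l) q.
Proof.
intros Hl H; apply west_of_east in H as [Hn He]; split;
  apply west_of_east_north; rewrite ?north_toward, ?east_toward; nra.
Qed.

(** For a follower deviating by [a] and a leader deviating by [b], a leader
    moving to its west only goes further ahead of the follower. *)
Lemma west_of_ahead (a b : R) (p q : point) : 0 <= a - b < PI ->
  west_of b p q -> ahead a p q.
Proof.
intros Hd [m [Hm ->]]; unfold ahead.
rewrite north_west_move, east_west_move.
destruct (Req_dec a b) as [->|Hab].
- right; rewrite Rminus_diag, sin_0, cos_0; lra.
- pose proof (sin_gt_0 (a - b)).
  destruct Hm as [Hm| <-]; [left; nra | right; lra].
Qed.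

(** In the frame [b] the west of [a] has north component [- sin (a - b)], so a follower that moves
    to its own west falls further behind the leader. For [a = b] the hypotheses contradict each
    other. *)
Lemma ahead_west_of (a b : R) (p q r : point) : 0 <= a - b < PI ->
  ahead b p q -> ~ ahead a p q -> west_of a p r -> ahead b r q.
Proof.
intros Hd Hb Ha [m [Hm ->]].
destruct (Req_dec a b) as [->|Hab]; [easy|].
apply ahead_trans with p; trivial; unfold ahead.
rewrite north_west_move, east_west_move, <- (Ropp_minus_distr a b), sin_neg.
pose proof (sin_gt_0 (a - b)).
destruct Hm as [Hm| <-]; [left; nra | right; lra].
Qed.

(** * The destination computed by the algorithm, in global coordinates *)

(** The scaling ratio is gone. The second test is the Rotate threshold, written as a sign of
    [cos (w - phi)] for the local polar angle [w]. *)
Definition target (phi a : R) (p q : point) : point :=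
  if excluded_middle_informative (ahead a p q) then q
  else if Rle_dec ((east a q - east a p) * cos phi
                   + (north a q - north a p) * sin phi) 0
  then west_move a p (dist p q)
  else p.

Lemma target_ahead (phi a : R) (p q : point) :
  ahead a p q -> target phi a p q = q.
Proof.
unfold target; now destruct (excluded_middle_informative (ahead a p q)).
Qed.

Lemma target_west_of (phi a : R) (p q : point) :
  ahead a q p -> west_of a p (target phi a p q).
Proof.
intros H; unfold target.
destruct (excluded_middle_informative (ahead a p q)) as [H'|H'].
- rewrite (ahead_antisym a p q) by trivial; apply west_of_refl.
- destruct Rle_dec; [exists (dist p q); split; trivial; apply dist_nonneg|].
  apply west_of_refl.
Qed.

Lemma A_SS_origin (phi : R) : A_SS phi (0, 0) = (0, 0).
Proof. unfold A_SS; now destruct excluded_middle_informative. Qed.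

Lemma A_SS_cartesian (phi x y : R) : 0 <= phi < PI / 2 -> (x, y) <> (0, 0) ->
  A_SS phi (x, y) =
  if excluded_middle_informative (0 < y \/ (y = 0 /\ x <= 0)) then (x, y)
  else if Rle_dec (x * cos phi + y * sin phi) 0 then (- norm (x, y), 0)
  else (0, 0).
Proof.
intros Hphi Hp; pose proof (norm_pos _ Hp) as Hn.
destruct (arg_spec _ Hp) as [Hw E]; unfold A_SS.
destruct excluded_middle_informative as [E0|_]; [now elim Hp|].
set (w := arg (x, y)) in *; set (n := norm (x, y)) in *.
injection E as Ex Ey; pose proof PI_RGT_0 as HPI.
pose proof (cos_sin_sqr w) as H1.
(* The left side is [n * cos (w - phi)], where [w - phi] lies between [PI / 2] and [2 * PI]; there
   the cosine is nonpositive exactly up to [3 * PI / 2]. *)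
assert (Hle : PI < w -> (x * cos phi + y * sin phi <= 0 <-> w <= 3 * PI / 2 + phi)).
{ intros Hw'; rewrite Ex, Ey.
  replace (n * cos w * cos phi + n * sin w * sin phi) with (n * cos (w - phi))
    by (rewrite cos_minus; ring).
  split; intros H.
  - destruct (Rle_lt_dec w (3 * PI / 2 + phi)) as [|L]; trivial.
    pose proof (cos_gt_0 (w - phi - 2 * PI) ltac:(lra) ltac:(lra)) as C.
    rewrite cos_minus, cos_2PI, sin_2PI in C; nra.
  - pose proof (cos_le_0 (w - phi) ltac:(lra) ltac:(lra)); nra. }
destruct (excluded_middle_informative (0 < w <= PI)) as [A|A];
  destruct (excluded_middle_informative (0 < y \/ (y = 0 /\ x <= 0))) as [B|B];
  trivial.
- exfalso; apply B; destruct (Req_dec w PI) as [Ew|Ew].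
  + right; rewrite Ex, Ey, Ew, sin_PI, cos_PI; lra.
  + left; rewrite Ey; pose proof (sin_gt_0 w); nra.
- exfalso; destruct (Req_dec w 0) as [Ew|Ew].
  + rewrite Ew, sin_0 in Ey; rewrite Ew, cos_0 in Ex; lra.
  + pose proof (sin_lt_0 w ltac:(lra) ltac:(lra)); nra.
- destruct (Req_dec w 0) as [Ew|Ew].
  + destruct (excluded_middle_informative (PI < w <= 3 * PI / 2 + phi)); [lra|].
    destruct Rle_dec as [L|]; trivial; exfalso.
    rewrite Ew, sin_0 in Ey; rewrite Ew, cos_0 in Ex.
    pose proof (cos_gt_0 phi ltac:(lra) ltac:(lra)); nra.
  + specialize (Hle ltac:(lra)).
    destruct (excluded_middle_informative (PI < w <= 3 * PI / 2 + phi)) as [C|C];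
      destruct Rle_dec as [L|L]; trivial; exfalso; apply L || apply C; tauto || lra.
Qed.

Lemma local_coord_east_north (p : point) (s a : R) (q : point) :
  local_coord p s a q = (s * (east a q - east a p), s * (north a q - north a p)).
Proof. unfold local_coord, east, north; f_equal; ring. Qed.

Lemma local_coord_inj (p : point) (s a : R) (q q' : point) : 0 < s ->
  local_coord p s a q = local_coord p s a q' -> q = q'.
Proof.
intros Hs; rewrite !local_coord_east_north; intros H; injection H as He Hn.
apply Rmult_eq_reg_l in He; [|lra]; apply Rmult_eq_reg_l in Hn; [|lra].
apply (east_north_inj a); lra.
Qed.

Lemma norm_local_coord (p : point) (s a : R) (q : point) : 0 < s ->
  norm (local_coord p s a q) = s * dist p q.
Proof.
intros Hs; rewrite local_coord_east_north, (dist_east_north a).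
unfold norm; simpl fst; simpl snd.
rewrite <- (sqrt_Rsqr s) at 3 by lra.
rewrite <- sqrt_mult_alt by apply Rle_0_sqr; f_equal; unfold Rsqr; ring.
Qed.

(** Every branch condition is invariant under positive scaling and every destination is homogeneous
    of degree one, so the adversary's [s] cancels. *)
Lemma A_SS_global (phi a s : R) (p o q : point) : 0 <= phi < PI / 2 -> 0 < s ->
  local_coord p s a q = A_SS phi (local_coord p s a o) -> q = target phi a p o.
Proof.
intros Hphi Hs Hq; apply (local_coord_inj p s a); trivial; rewrite Hq; clear q Hq.
destruct (excluded_middle_informative (o = p)) as [->|Hop].
{ rewrite target_ahead by apply ahead_refl.
  rewrite local_coord_east_north, !Rminus_diag, Rmult_0_r; apply A_SS_origin. }
assert (H0 : local_coord p s a o <> (0, 0)).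
{ intros E; apply Hop, (local_coord_inj p s a); trivial; rewrite E.
  rewrite local_coord_east_north; f_equal; ring. }
pose proof (norm_local_coord p s a o Hs) as Hn.
rewrite local_coord_east_north in *.
set (x := east a o - east a p) in *; set (y := north a o - north a p) in *.
rewrite A_SS_cartesian, Hn by trivial; unfold target; fold x y.
replace (s * x * cos phi + s * y * sin phi) with (s * (x * cos phi + y * sin phi))
  by ring.
destruct (excluded_middle_informative (ahead a p o)) as [A|A];
  destruct (excluded_middle_informative (0 < s * y \/ (s * y = 0 /\ s * x <= 0)))
  as [B|B].
- now rewrite local_coord_east_north; fold x y.
- exfalso; apply B; unfold ahead in A.
  destruct A as [A|[A A']]; [left; unfold y; nra | right; unfold x, y; nra].
- exfalso; apply A; unfold ahead; subst x y.
  destruct B as [B|[B B']]; [left; nra | right; split; nra].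
- rewrite local_coord_east_north.
  destruct Rle_dec as [C|C]; destruct Rle_dec as [D|D];
    try (exfalso; first [apply C | apply D]; nra).
  + rewrite east_west_move_same, north_west_move_same; f_equal; ring.
  + f_equal; ring.
Qed.

(** * A pursuit on a line *)

(** The Archimedean property, in the form used for all termination arguments. [P] selects the
    activation times of one robot, as progress is only guaranteed from one activation to the
    next. *)
Lemma no_endless_descent (P : nat -> Prop) (q : nat -> R) (m eta : R) (T : nat) :
  0 < eta -> P T ->
  (forall t, (T <= t)%nat -> P t -> m <= q t) ->
  (forall t, (T <= t)%nat -> P t ->
     exists t', (t <= t')%nat /\ P t' /\ q t' <= q t - eta) ->
  False.
Proof.
intros Heta HT Hm Hd.
assert (H : forall k : nat, exists t, (T <= t)%nat /\ P t /\ q t <= q T - INR k * eta).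
{ induction k as [|k [t [Ht [HP Hq]]]].
  - exists T; simpl; repeat split; trivial; lra.
  - destruct (Hd t Ht HP) as [t' [Ht' [HP' Hq']]].
    exists t'; rewrite S_INR; repeat split; trivial; [lia | lra]. }
destruct (INR_unbounded ((q T - m) / eta)) as [k Hk].
destruct (H k) as [t [Ht [HP Hq]]]; specialize (Hm t Ht HP).
apply Rmult_lt_compat_r with (r := eta) in Hk; trivial.
unfold Rdiv in Hk; rewrite Rmult_assoc, Rinv_l in Hk by lra; lra.
Qed.

Lemma nat_first (P : nat -> Prop) (T n : nat) : (T <= n)%nat -> P n ->
  exists k, (T <= k)%nat /\ P k /\ forall m, (T <= m < k)%nat -> ~ P m.
Proof.
revert T; induction n as [n IH] using (well_founded_induction lt_wf).
intros T HT HP.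
destruct (excluded_middle_informative (exists m, (T <= m < n)%nat /\ P m))
  as [[m [Hm HPm]]|H].
- apply (IH m); trivial; lia.
- exists n; repeat split; trivial; intros m Hm HPm; apply H; now exists m.
Qed.

Set Implicit Arguments.

(** In the coordinates of the leader, whose west is the direction of decreasing
    abscissas: [A] and [Z] are the abscissas of the leader and of its pending
    destination; the follower is at [(X, - H)], with pending destination
    [(B, 0)]. *)
Record pursuit (K delta : R) (lact fact : nat -> Prop) (A Z X B H : nat -> R)
  : Prop := {
  gap_nonneg : forall n, 0 <= H n;
  gap_zero : forall n, H n = 0 -> A n <= X n;
  leader_pending : forall n, Z n <= A n;
  follower_pending : forall n, A n <= B n;
  leader_step : forall n, exists l, 0 <= l <= 1 /\ A (S n) = A n + l * (Z n - A n);
  leader_aim : forall n, lact n ->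
    Z n = A n \/
    (X n - A n <= K * H n /\ A n - Z n <= Rabs (X n - A n) + H n);
  leader_keep : forall n, ~ lact (S n) -> Z (S n) = Z n;
  leader_active : forall n, exists t, (n <= t)%nat /\ lact t;
  follower_step : forall n, exists l, 0 <= l <= 1 /\
    X (S n) = X n + l * (B n - X n) /\ H (S n) = H n - l * H n;
  follower_aim : forall n, fact n -> B n = A n;
  follower_keep : forall n, ~ fact (S n) -> B (S n) = B n;
  follower_active : forall n, exists t, (n <= t)%nat /\ fact t;
  follower_round : forall t, fact t -> exists t' l, (t <= t')%nat /\ fact t' /\
    0 <= l <= 1 /\ X t' = X t + l * (B t - X t) /\ H t' = H t - l * H t /\
    (l = 1 \/ delta <= Rabs (X t' - X t) + Rabs (H t' - H t))
}.

Unset Implicit Arguments.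

Section Pursuit.

Context (K delta : R) (lact fact : nat -> Prop) (A Z X B H : nat -> R).
Context (HK : 0 <= K) (Hdelta : 0 < delta).
Context (HP : pursuit K delta lact fact A Z X B H).

Lemma leader_decr (n m : nat) : (n <= m)%nat -> A m <= A n.
Proof.
induction 1 as [|m _ IH]; [lra|].
destruct (leader_step HP m) as [l [Hl E]].
pose proof (leader_pending HP m); nra.
Qed.

Lemma gap_decr (n m : nat) : (n <= m)%nat -> H m <= H n.
Proof.
induction 1 as [|m _ IH]; [lra|].
destruct (follower_step HP m) as [l [Hl [_ E]]].
pose proof (gap_nonneg HP m); nra.
Qed.

(** The follower moves between two abscissas that are at least [A n], while the leader only goes
    west. *)
Lemma overtaken (n m : nat) : (n <= m)%nat -> A n <= X n -> A m <= X m.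
Proof.
intros Hnm H0; induction Hnm as [|m _ IH]; trivial.
destruct (follower_step HP m) as [l [Hl [E _]]].
pose proof (follower_pending HP m).
pose proof (leader_decr m (S m) ltac:(lia)); nra.
Qed.

(** The activation at [T] discards a destination chosen before the overtaking, which could lie to
    the east; later ones are positions of the leader. *)
Lemma overtaken_pending (T n : nat) : (T <= n)%nat -> fact T -> A T <= X T ->
  B n <= X n.
Proof.
intros Hn HT H0; induction Hn as [|n Hn IH].
- rewrite (follower_aim HP T HT); lra.
- destruct (excluded_middle_informative (fact (S n))) as [F|F].
  + rewrite (follower_aim HP _ F).
    apply overtaken with T; trivial; lia.
  + rewrite (follower_keep HP _ F).
    destruct (follower_step HP n) as [l [Hl [E _]]]; nra.
Qed.

Lemma overtaken_decr (T n m : nat) : (T <= n <= m)%nat -> fact T -> A T <= X T ->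
  X m <= X n.
Proof.
intros [HT Hnm] F H0; induction Hnm as [|m Hnm IH]; [lra|].
destruct (follower_step HP m) as [l [Hl [E _]]].
pose proof (overtaken_pending T m ltac:(lia) F H0); nra.
Qed.

Lemma overtaken_round (T t : nat) : (T <= t)%nat -> fact T -> A T <= X T ->
  fact t -> exists t' l, (t <= t')%nat /\ fact t' /\ 0 <= l <= 1 /\
    X t' = X t + l * (A t - X t) /\ H t' = H t - l * H t /\
    (l = 1 \/ delta <= l * (X t - A t + H t)).
Proof.
intros Ht FT H0 F.
destruct (follower_round HP t F)
  as [t' [l [Ht' [F' [Hl [EX [EH Hd]]]]]]].
rewrite (follower_aim HP t F) in EX.
exists t', l; repeat split; try tauto; trivial.
destruct Hd as [Hd|Hd]; [now left|right].
pose proof (overtaken T t Ht H0).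
pose proof (gap_nonneg HP t).
rewrite EX, EH, !Rabs_left1 in Hd by nra; lra.
Qed.

Definition caught : Prop :=
  exists k, forall n, (k <= n)%nat -> H n = 0 /\ X n = A n /\ A n = A k.

(** The distance [X t - A T + H t] to the fixed leader drops by [delta] in every round that does not
    end at the leader. *)
Lemma caught_idle_leader (T : nat) : fact T -> A T <= X T ->
  (forall n, (T <= n)%nat -> A n = A T) -> caught.
Proof.
intros F H0 HA.
assert (HB : forall n, (T <= n)%nat -> B n = A T).
{ induction 1 as [|n Hn IH]; [apply (follower_aim HP T F)|].
  destruct (excluded_middle_informative (fact (S n))) as [F'|F'].
  - rewrite (follower_aim HP _ F'); apply HA; lia.
  - now rewrite (follower_keep HP _ F'). }
destruct (excluded_middle_informative
  (exists t, (T <= t)%nat /\ X t = A T /\ H t = 0)) as [[t [Ht [EX EH]]]|Hn].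
- exists t; intros n Hn.
  rewrite (HA n) by lia; rewrite (HA t) by lia.
  cut (X n = A T /\ H n = 0); [tauto|].
  induction Hn as [|n Hn IH]; [tauto|].
  destruct (follower_step HP n) as [l [Hl [E E']]].
  rewrite E, E', HB by lia; destruct IH as [-> ->]; lra.
- exfalso.
  apply (no_endless_descent fact (fun t => X t - A T + H t) 0 delta T); trivial.
  + intros t Ht _; pose proof (overtaken T t Ht H0).
    pose proof (gap_nonneg HP t).
    pose proof (HA t Ht); lra.
  + intros t Ht Ft.
    destruct (overtaken_round T t Ht F H0 Ft)
      as [t' [l [Ht' [F' [Hl [EX [EH Hd]]]]]]].
    rewrite (HA t Ht) in EX, Hd.
    exists t'; repeat split; trivial.
    destruct Hd as [->|Hd]; [exfalso; apply Hn; exists t'|].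
    * split; [lia|]; split; lra.
    * nra.
Qed.

Lemma leader_waits (T : nat) :
  (forall n, (T <= n)%nat -> lact n -> Z n = A n) ->
  exists T', (T <= T')%nat /\ forall n, (T' <= n)%nat -> A n = A T'.
Proof.
(* A rotation begun before [T] may still be pending; the next activation ends it. *)
intros HZ; destruct (leader_active HP T) as [T' [HT' L]].
exists T'; split; trivial; intros n Hn.
cut (A n = A T' /\ Z n = A n); [tauto|].
induction Hn as [|n Hn IH]; [auto|].
destruct (leader_step HP n) as [l [Hl E]].
assert (EA : A (S n) = A n) by (rewrite E; destruct IH as [_ ->]; ring).
split; [lra|].
destruct (excluded_middle_informative (lact (S n))) as [L'|L'].
- apply HZ; trivial; lia.
- rewrite (leader_keep HP _ L'); lra.
Qed.

Lemma caught_waiting_leader (T : nat) :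
  (forall n, (T <= n)%nat -> lact n -> Z n = A n) -> A T <= X T -> caught.
Proof.
intros HZ H0; destruct (leader_waits T HZ) as [T' [HT' HA]].
destruct (follower_active HP T') as [T'' [HT'' F]].
apply caught_idle_leader with T''; trivial.
- apply overtaken with T; trivial; lia.
- intros n Hn; rewrite (HA n) by lia; rewrite (HA T'') by lia; reflexivity.
Qed.

(** A rotating leader lands at distance [O(H)] of the follower, whatever the
    follower does in the meantime. *)
Lemma leader_rotation_gap (n : nat) : A n <= X n ->
  X n - A n <= K * H n /\ A n - Z n <= Rabs (X n - A n) + H n ->
  X n - Z n <= (2 * K + 1) * H n.
Proof. intros H0 [H1 H2]; rewrite Rabs_right in H2 by lra; lra. Qed.

(** [X] decreases, a wait moves [Z] back east to [A], and a new rotation obeys [leader_rotation_gap]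
    with a gap no larger than [H t]. *)
Lemma pending_gap (T t n : nat) (m : R) :
  fact T -> A T <= X T -> (T <= t <= n)%nat ->
  X t - Z t <= m -> (2 * K + 1) * H t <= m -> X n - Z n <= m.
Proof.
intros F H0 [Ht Hn] Hm HmH; induction Hn as [|n Hn IH]; trivial.
pose proof (overtaken_decr T n (S n) ltac:(lia) F H0) as HX.
destruct (excluded_middle_informative (lact (S n))) as [L|L].
- destruct (leader_aim HP _ L) as [E|E].
  + destruct (leader_step HP n) as [l [Hl E']].
    pose proof (leader_pending HP n); nra.
  + apply leader_rotation_gap in E; [|apply overtaken with T; trivial; lia].
    pose proof (gap_decr t (S n) ltac:(lia)); nra.
- rewrite (leader_keep HP _ L); lra.
Qed.

(** By [pending_gap] the way to the destination is at most [m + H T]. An unfinished round thus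
    covers a fraction at least [delta / (m + H T)] of it, and the gap shrinks by that fraction. *)
Lemma gap_small (T : nat) (eps : R) : 0 < eps -> fact T -> A T <= X T ->
  (forall n, (T <= n)%nat -> 0 < H n) ->
  exists t, (T <= t)%nat /\ H t < eps.
Proof.
intros Heps F H0 Hpos.
destruct (excluded_middle_informative (exists t, (T <= t)%nat /\ H t < eps))
  as [|Hn]; trivial; exfalso.
set (m := Rmax (X T - Z T) ((2 * K + 1) * H T)).
assert (Hm : forall n, (T <= n)%nat -> X n - Z n <= m).
{ intros n Hle; apply (pending_gap T T n); trivial; [lia| |];
    [apply Rmax_l | apply Rmax_r]. }
assert (Hm0 : 0 < m).
{ apply Rlt_le_trans with ((2 * K + 1) * H T); [|apply Rmax_r].
  pose proof (Hpos T (le_n T)); nra. }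
pose proof (Hpos T (le_n T)) as HT0.
assert (Heta : 0 < delta / (m + H T)) by (apply Rdiv_lt_0_compat; lra).
apply (no_endless_descent fact H 0 (delta / (m + H T) * eps) T); trivial.
- apply Rmult_lt_0_compat; trivial.
- intros t _ _; apply (gap_nonneg HP).
- intros t Ht Ft.
  destruct (overtaken_round T t Ht F H0 Ft)
    as [t' [l [Ht' [F' [Hl [EX [EH Hd]]]]]]].
  exists t'; repeat split; trivial.
  assert (He : eps <= H t).
  { destruct (Rle_lt_dec eps (H t)); trivial; exfalso; apply Hn; now exists t. }
  destruct Hd as [->|Hd].
  + pose proof (Hpos t' ltac:(lia)); lra.
  + pose proof (Hm t Ht) as Hmt.
    pose proof (leader_pending HP t).
    pose proof (gap_decr T t Ht) as HHt.
    assert (Hl' : delta <= l * (m + H T)) by nra.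
    assert (Hll : delta / (m + H T) <= l).
    { apply Rmult_le_reg_r with (m + H T); [lra|].
      unfold Rdiv; rewrite Rmult_assoc, Rinv_l; lra. }
    rewrite EH; nra.
Qed.

(** Until then the follower moves north and east, so [H - X] loses [delta] per round although it
    stays above [- A 0]. A finished round would close the gap. *)
Lemma eventually_overtaken : (forall n, 0 < H n) -> exists n, A n <= X n.
Proof.
intros Hpos.
destruct (excluded_middle_informative (exists n, A n <= X n)) as [|Hn]; trivial.
exfalso.
assert (Hlt : forall n, X n < A n).
{ intros n; destruct (Rle_lt_dec (A n) (X n)); trivial.
  exfalso; apply Hn; now exists n. }
destruct (follower_active HP 0) as [T [_ F]].
apply (no_endless_descent fact (fun t => H t - X t) (- A 0%nat) delta T); trivial.
- intros t Ht _; pose proof (Hlt t); pose proof (Hpos t).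
  pose proof (leader_decr 0 t ltac:(lia)); lra.
- intros t Ht Ft.
  destruct (follower_round HP t Ft)
    as [t' [l [Ht' [F' [Hl [EX [EH Hd]]]]]]].
  rewrite (follower_aim HP t Ft) in EX.
  exists t'; repeat split; trivial.
  pose proof (Hlt t); pose proof (Hpos t); pose proof (Hpos t').
  destruct Hd as [->|Hd]; [lra|].
  rewrite (Rabs_right (X t' - X t)) in Hd by nra.
  rewrite (Rabs_left1 (H t' - H t)) in Hd by nra; lra.
Qed.

(** If the gap never vanishes then the follower never reaches a destination. The
    gap is eventually so small that after a further rotation of the leader the
    follower would be within [delta] of it. *)
Lemma pursuit_caught : caught.
Proof.
destruct (excluded_middle_informative (exists T, H T = 0)) as [[T HT]|Hn].
- assert (HH : forall n, (T <= n)%nat -> H n = 0).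
  { intros n Hn; pose proof (gap_decr T n Hn).
    pose proof (gap_nonneg HP n); lra. }
  apply caught_waiting_leader with T; [|now apply (gap_zero HP)].
  intros n Hn L.
  destruct (leader_aim HP n L) as [E|[E E']]; trivial.
  (* Without a gap a rotation forces [X n = A n], hence has length 0. *)
  pose proof (gap_zero HP n (HH n Hn)).
  pose proof (leader_pending HP n).
  rewrite (HH n Hn) in E, E'; rewrite Rabs_right in E' by lra; lra.
- assert (Hpos : forall n, 0 < H n).
  { intros n; pose proof (gap_nonneg HP n) as [|E]; trivial.
    exfalso; apply Hn; now exists n. }
  destruct (eventually_overtaken Hpos) as [n0 Hn0].
  destruct (follower_active HP n0) as [T [HT F]].
  pose proof (overtaken n0 T HT Hn0) as H0.
  (* The coefficient is [2 * K + 1] for the horizontal bound on [X - Z] plus 1 for the gap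
     itself. *)
  assert (Heps : 0 < delta / (2 * K + 2)) by (apply Rdiv_lt_0_compat; lra).
  destruct (gap_small T _ Heps F H0) as [t [Ht Hsmall]]; [intros; apply Hpos|].
  apply caught_waiting_leader with t; [|apply overtaken with T; trivial].
  intros n Hn' L.
  destruct (leader_aim HP n L) as [E|E]; trivial; exfalso.
  apply leader_rotation_gap in E; [|apply overtaken with T; trivial; lia].
  destruct (follower_active HP n) as [u [Hu Fu]].
  pose proof (pending_gap T n u _ F H0 ltac:(lia) E ltac:(lra)) as Hgap.
  destruct (overtaken_round T u ltac:(lia) F H0 Fu)
    as [t' [l [Ht' [F' [Hl [EX [EH Hd]]]]]]].
  destruct Hd as [->|Hd]; [pose proof (Hpos t'); lra|].
  pose proof (leader_pending HP u).
  pose proof (gap_decr n u Hu); pose proof (gap_decr t n Hn').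
  pose proof (overtaken T u ltac:(lia) H0); pose proof (Hpos u).
  assert (H n * (2 * K + 2) < delta).
  { apply Rmult_lt_reg_r with (/ (2 * K + 2)); [apply Rinv_0_lt_compat; lra|].
    rewrite Rmult_assoc, Rinv_r by lra; unfold Rdiv in Hsmall; lra. }
  nra.
Qed.

End Pursuit.

(** * The motion of the robots, observed at integer times *)

Set Implicit Arguments.

(** [r i n] is the position of robot [i] at time [n], and [d i n] the
    destination towards which it moves between [n] and [n + 1]. *)
Record motion (phi delta : R) (a : bool -> R) (act : bool -> nat -> Prop)
  (r d : bool -> nat -> point) : Prop := {
  idle : forall i, ~ act i 0%nat -> d i 0%nat = r i 0%nat;
  step : forall i n, exists l, 0 <= l <= 1 /\ r i (S n) = toward (r i n) (d i n) l;
  aim : forall i n, act i n -> d i n = target phi (a i) (r i n) (r (negb i) n);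
  keep : forall i n, ~ act i (S n) -> d i (S n) = d i n;
  active : forall i n, exists t, (n <= t)%nat /\ act i t;
  round : forall i t, act i t -> exists t' l, (t <= t')%nat /\ act i t' /\
    0 <= l <= 1 /\ r i t' = toward (r i t) (d i t) l /\
    (l = 1 \/ delta <= dist (r i t) (r i t'))
}.

Unset Implicit Arguments.

Definition gathers (r : bool -> nat -> point) : Prop :=
  exists p k, forall i n, (k <= n)%nat -> r i n = p.

Lemma dist_toward (p q : point) (s s' : R) :
  dist (toward p q s) (toward p q s') = Rabs (s' - s) * dist p q.
Proof.
rewrite <- (sqrt_Rsqr_abs (s' - s)); unfold dist, norm.
rewrite <- sqrt_mult_alt by apply Rle_0_sqr.
f_equal; unfold toward, Rsqr; simpl; ring.
Qed.

Lemma dist_west_move (a : R) (p : point) (m : R) : 0 <= m ->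
  dist p (west_move a p m) = m.
Proof.
intros Hm; rewrite (dist_east_north a), east_west_move_same, north_west_move_same.
rewrite <- (sqrt_Rsqr m) at 2 by trivial; f_equal; unfold Rsqr; ring.
Qed.

Lemma toward_west_move (a : R) (p : point) (m l : R) :
  toward p (west_move a p m) l = west_move a p (l * m).
Proof. unfold toward, west_move; simpl; f_equal; ring. Qed.

Lemma toward_rev (p q : point) (s : R) : toward q p s = toward p q (1 - s).
Proof. unfold toward; f_equal; ring. Qed.

Lemma toward_toward (p q : point) (s s' l : R) :
  toward (toward p q s) (toward p q s') l = toward p q (s + l * (s' - s)).
Proof. unfold toward; simpl; f_equal; ring. Qed.

Lemma toward_inj (p q : point) (s s' : R) : p <> q ->
  toward p q s = toward p q s' -> s = s'.
Proof.
destruct p as [x y], q as [x' y']; unfold toward; simpl; intros Hpq E.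
injection E as Ex Ey.
destruct (Req_dec x x') as [Hx|Hx]; [destruct (Req_dec y y') as [Hy|Hy]|].
- now subst.
- apply Rmult_eq_reg_r with (y' - y); lra.
- apply Rmult_eq_reg_r with (x' - x); lra.
Qed.

Lemma ahead_toward_inv (a : R) (p q : point) (s s' : R) : p <> q ->
  ahead a p q -> ahead a (toward p q s) (toward p q s') -> s <= s'.
Proof.
intros Hpq H Hs; destruct (Rle_lt_dec s s') as [|L]; trivial.
right; apply (toward_inj p q); trivial; apply (ahead_antisym a); trivial.
apply ahead_toward_toward; trivial; lra.
Qed.

Lemma ahead_toward_rev (a : R) (p q : point) (s s' : R) :
  ahead a q p -> s' <= s -> ahead a (toward p q s) (toward p q s').
Proof.
intros H Hs; rewrite !(toward_rev q p); apply ahead_toward_toward; trivial; lra.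
Qed.

(** At equal heights [q] would be west of [p] for [b], and [west_of_ahead] would make the follower
    approach. *)
Lemma ahead_north_lt (a b : R) (p q : point) : 0 <= a - b < PI ->
  ahead b p q -> ~ ahead a p q -> north b p < north b q.
Proof.
intros Hd [H|[H H']] Ha; trivial.
exfalso; apply Ha, (west_of_ahead a b); trivial.
now apply west_of_east_north.
Qed.

(** A robot at [q] that is ahead of a robot at [p] that declines to approach
    never waits: as [a - b <= 2 * phi], the latter is too far to the west. *)
Lemma target_rotate (phi a b : R) (p q : point) :
  0 <= phi < PI / 2 -> 0 <= a - b <= 2 * phi ->
  ahead b p q -> ~ ahead a p q -> target phi b q p = west_move b q (dist q p).
Proof.
intros Hphi Hd Hb Ha.
pose proof (ahead_north_lt a b p q ltac:(lra) Hb Ha) as HN.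
assert (Hab : a <> b) by (intros ->; contradiction).
unfold target; destruct excluded_middle_informative as [H|_];
  [unfold ahead in H; lra|].
destruct Rle_dec as [_|C]; trivial; exfalso; apply C; clear C.
apply not_ahead in Ha.
assert (Hy : north a q <= north a p) by (unfold ahead in Ha; lra).
set (x := east b p - east b q); set (y := north b p - north b q).
assert (Ey : north a p - north a q = cos (a - b) * y - sin (a - b) * x).
{ unfold x, y, east, north; rewrite cos_minus, sin_minus.
  pose proof (cos_sin_sqr b) as H1.
  set (u := fst p - fst q); set (v := snd p - snd q).
  transitivity ((cos b * cos b + sin b * sin b) * (- sin a * u + cos a * v));
    [rewrite H1; unfold u, v; ring | unfold u, v; ring]. }
pose proof (sin_gt_0 (a - b) ltac:(lra) ltac:(lra)) as Hs.
pose proof (cos_ge_0 (a - b - phi) ltac:(lra) ltac:(lra)) as Hc.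
rewrite cos_minus in Hc.
pose proof (cos_gt_0 phi ltac:(lra) ltac:(lra)).
assert (Hy0 : y < 0) by (unfold y; lra).
(* The refusal gives [S * x <= C * y], so the product is at most [y * cos (a - b - phi)], where
   [y < 0] and the angle is within [phi] of 0. *)
apply Rmult_le_reg_l with (sin (a - b)); trivial; rewrite Rmult_0_r.
set (S := sin (a - b)) in *; set (C := cos (a - b)) in *.
assert (S * x <= C * y) by lra.
assert (y * (C * cos phi + S * sin phi) <= 0) by nra.
nra.
Qed.

(** * Leaders and followers *)

Section Motion.

Context (phi delta : R) (Hphi : 0 <= phi < PI / 2) (Hdelta : 0 < delta).
Context (a : bool -> R) (Ha : forall i, Rabs (a i) <= phi).
Context (act : bool -> nat -> Prop) (r d : bool -> nat -> point).
Context (M : motion phi delta a act r d).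

Definition lead (j : bool) (n : nat) : Prop :=
  ahead (a j) (r (negb j) n) (r j n) /\
  ahead (a j) (d (negb j) n) (r j n) /\
  west_of (a j) (r j n) (d j n).

(** This is the state at [S n] before new destinations are chosen. The set of points behind the
    leader is convex and grows as the leader goes west. *)
Lemma lead_move (j : bool) (n : nat) : lead j n ->
  ahead (a j) (r (negb j) (S n)) (r j (S n)) /\
  ahead (a j) (d (negb j) n) (r j (S n)) /\
  west_of (a j) (r j (S n)) (d j n).
Proof.
intros [H1 [H2 H3]].
destruct (step M j n) as [l [Hl E]].
destruct (step M (negb j) n) as [l' [Hl' E']].
destruct (west_of_toward _ _ _ l Hl H3) as [H4 H5]; rewrite <- E in H4, H5.
apply west_of_ahead with (a := a j) in H4; [|pose proof PI_RGT_0; lra].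
repeat split; trivial.
- apply ahead_trans with (r j n); trivial; rewrite E'; now apply toward_ahead.
- now apply ahead_trans with (r j n).
Qed.

Lemma west_of_update (j : bool) (n : nat) :
  ahead (a j) (r (negb j) (S n)) (r j (S n)) ->
  west_of (a j) (r j (S n)) (d j n) -> west_of (a j) (r j (S n)) (d j (S n)).
Proof.
intros H H'; destruct (excluded_middle_informative (act j (S n))) as [A|A].
- rewrite (aim M _ _ A); now apply target_west_of.
- now rewrite (keep M _ _ A).
Qed.

Lemma lead_step (j : bool) (n : nat) : lead j n ->
  (act (negb j) (S n) -> ahead (a j) (d (negb j) (S n)) (r j (S n))) ->
  lead j (S n).
Proof.
intros L H; destruct (lead_move j n L) as [H1 [H2 H3]].
split; [|split]; trivial.
- destruct (excluded_middle_informative (act (negb j) (S n))) as [A|A]; auto.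
  now rewrite (keep M _ _ A).
- now apply west_of_update.
Qed.

Lemma lead_following (j : bool) (T n : nat) : lead j T ->
  (forall m, (T < m <= n)%nat -> act (negb j) m ->
     ahead (a (negb j)) (r (negb j) m) (r j m)) ->
  (T <= n)%nat -> lead j n.
Proof.
intros L HF Hn; induction Hn as [|n Hn IH]; trivial.
apply lead_step.
- apply IH; intros m Hm; apply HF; lia.
- intros A; rewrite (aim M _ _ A), Bool.negb_involutive.
  rewrite target_ahead; [apply ahead_refl | apply HF; trivial; lia].
Qed.

(** An instance of [pursuit] in the frame of [j]. The activation at [T] puts the destination of the
    follower on the line of the leader, at height [v]. *)
Lemma follow_active (j : bool) (T : nat) : lead j T ->
  (forall n, (T <= n)%nat -> act (negb j) n ->
     ahead (a (negb j)) (r (negb j) n) (r j n)) ->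
  act (negb j) T -> gathers r.
Proof.
intros L HF AT; set (f := negb j) in *.
assert (Hlead : forall n, (T <= n)%nat -> lead j n).
{ intros n Hn; apply lead_following with T; trivial.
  intros m Hm; apply HF; lia. }
assert (Haim : forall n, (T <= n)%nat -> act f n -> d f n = r j n).
{ intros n Hn A; rewrite (aim M _ _ A).
  replace (negb f) with j by (unfold f; now rewrite Bool.negb_involutive).
  apply target_ahead, HF; trivial. }
set (v := north (a j) (r j T)).
assert (Hd : forall n, (T <= n)%nat -> north (a j) (d j n) = north (a j) (r j n)
  /\ east (a j) (d j n) <= east (a j) (r j n)).
{ intros n Hn; now apply west_of_east, Hlead. }
assert (Hv : forall n, (T <= n)%nat -> north (a j) (r j n) = v).
{ induction 1 as [|n Hn IH]; [reflexivity|].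
  destruct (step M j n) as [l [Hl ->]].
  rewrite north_toward; destruct (Hd n Hn) as [-> _]; lra. }
assert (Hf : forall n, (T <= n)%nat ->
  north (a j) (d f n) = v /\ east (a j) (r j n) <= east (a j) (d f n)).
{ induction 1 as [|n Hn IH].
  - rewrite Haim by trivial; split; [reflexivity | lra].
  - destruct (excluded_middle_informative (act f (S n))) as [A|A].
    + rewrite Haim by (trivial; lia); split; [apply Hv; lia | lra].
    + rewrite (keep M _ _ A); split; [tauto|].
      destruct (step M j n) as [l [Hl ->]].
      rewrite east_toward; destruct (Hd n Hn) as [_ H]; nra. }
pose proof (cos_gt_0 phi ltac:(lra) ltac:(lra)) as Hc.
assert (Hs : 0 <= sin phi) by (apply sin_ge_0; lra).
assert (HP : pursuit (sin phi / cos phi) delta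
  (fun n => act j (T + n)) (fun n => act f (T + n))
  (fun n => east (a j) (r j (T + n))) (fun n => east (a j) (d j (T + n)))
  (fun n => east (a j) (r f (T + n))) (fun n => east (a j) (d f (T + n)))
  (fun n => v - north (a j) (r f (T + n)))).
{ split.
  - intros n; rewrite <- (Hv (T + n)%nat) by lia.
    destruct (Hlead (T + n)%nat ltac:(lia)) as [[H|[H _]] _]; fold f in H; lra.
  - intros n; rewrite <- (Hv (T + n)%nat) by lia.
    destruct (Hlead (T + n)%nat ltac:(lia)) as [[H|[H H']] _]; fold f in H; [lra|].
    trivial.
  - intros n; apply Hd; lia.
  - intros n; apply Hf; lia.
  - intros n; destruct (step M j (T + n)%nat) as [l [Hl E]].
    exists l; split; trivial; now rewrite Nat.add_succ_r, E, east_toward.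
  - intros n A; rewrite (aim M _ _ A); fold f; unfold target.
    destruct excluded_middle_informative as [H|H].
    { left; f_equal; apply (ahead_antisym (a j)); trivial; apply Hlead; lia. }
    destruct Rle_dec as [H'|H']; [right | now left].
    rewrite Hv in H' by lia; rewrite east_west_move_same; split.
    (* The Rotate test is a bound on the eastward offset by [h * sin phi / cos phi]; hence [K] is
       the tangent of [phi]. *)
    + apply Rmult_le_reg_r with (cos phi); trivial.
      set (h := v - north (a j) (r f (T + n)%nat)) in *.
      replace (sin phi / cos phi * h * cos phi) with (h * sin phi)
        by (field; lra).
      replace (north (a j) (r f (T + n)%nat) - v) with (- h) in H'
        by (unfold h; ring); lra.
    + pose proof (dist_le_east_north (a j) (r j (T + n)%nat) (r f (T + n)%nat)) as D.
      assert (Hle : north (a j) (r f (T + n)%nat) <= v).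
      { rewrite <- (Hv (T + n)%nat) by lia.
        destruct (Hlead (T + n)%nat ltac:(lia)) as [[G|[G _]] _]; fold f in G; lra. }
      rewrite Hv in D by lia; rewrite (Rabs_left1 (north _ _ - v)) in D by lra; lra.
  - intros n; rewrite Nat.add_succ_r; intros A.
    now rewrite (keep M _ _ A).
  - intros n; destruct (active M j (T + n)%nat) as [t [Ht A]].
    exists (t - T)%nat; split; [lia|]; now replace (T + (t - T))%nat with t by lia.
  - intros n; destruct (step M f (T + n)%nat) as [l [Hl E]].
    exists l; split; trivial; rewrite Nat.add_succ_r, E, east_toward, north_toward.
    destruct (Hf (T + n)%nat ltac:(lia)) as [-> _]; split; ring.
  - intros n A; rewrite Haim; trivial; lia.
  - intros n; rewrite Nat.add_succ_r; intros A.
    now rewrite (keep M _ _ A).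
  - intros n; destruct (active M f (T + n)%nat) as [t [Ht A]].
    exists (t - T)%nat; split; [lia|]; now replace (T + (t - T))%nat with t by lia.
  - intros n A; destruct (round M f _ A) as [t' [l [Ht [A' [Hl [E D]]]]]].
    exists (t' - T)%nat, l; replace (T + (t' - T))%nat with t' by lia.
    rewrite E at 1 2; rewrite east_toward, north_toward.
    destruct (Hf (T + n)%nat ltac:(lia)) as [-> _].
    repeat split; try tauto; try lia; try ring.
    destruct D as [D|D]; [now left | right].
    apply Rle_trans with (1 := D); apply Rle_trans with
      (1 := dist_le_east_north (a j) _ _).
    apply Rplus_le_compat_l; rewrite <- Rabs_Ropp; right; f_equal; ring. }
apply pursuit_caught in HP; trivial;
  [|apply Rmult_le_pos; trivial; apply Rlt_le, Rinv_0_lt_compat; trivial].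
destruct HP as [k Hk].
exists (r j (T + k)%nat), (T + k)%nat.
assert (Hj : forall n, (T + k <= n)%nat -> r j n = r j (T + k)%nat /\ r f n = r j n).
{ intros n Hn; destruct (Hk (n - T)%nat ltac:(lia)) as [HH [HX HA]].
  replace (T + (n - T))%nat with n in * by lia.
  split; apply (east_north_inj (a j)); trivial; rewrite !Hv by lia; lra. }
intros i n Hn; destruct (Hj n Hn) as [E E'].
destruct (Bool.bool_dec i j) as [->|Hij]; trivial.
replace i with f by (unfold f; destruct i, j; easy); now rewrite E'.
Qed.

Lemma follow (j : bool) (T : nat) : lead j T ->
  (forall n, (T <= n)%nat -> act (negb j) n ->
     ahead (a (negb j)) (r (negb j) n) (r j n)) -> gathers r.
Proof.
intros L HF; destruct (active M (negb j) T) as [t [Ht A]].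
apply follow_active with j t; trivial.
- apply lead_following with T; trivial; intros m Hm; apply HF; lia.
- intros n Hn; apply HF; lia.
Qed.

Lemma deviation_gap (j : bool) : a j <= a (negb j) ->
  0 <= a (negb j) - a j <= 2 * phi.
Proof.
intros H; pose proof (Ha j) as H1; pose proof (Ha (negb j)) as H2.
unfold Rabs in H1, H2; destruct (Rcase_abs (a j)), (Rcase_abs (a (negb j))); lra.
Qed.

(** A follower that approaches aims at the leader itself; one that does not stays behind by
    [ahead_west_of]. *)
Lemma lead_forever (j : bool) (T n : nat) : a j <= a (negb j) -> lead j T ->
  (T <= n)%nat -> lead j n.
Proof.
intros Hj L Hn; induction Hn as [|n Hn IH]; trivial.
apply lead_step; trivial; intros A.
destruct (lead_move j n IH) as [H [_ _]].
rewrite (aim M _ _ A), Bool.negb_involutive.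
destruct (excluded_middle_informative
  (ahead (a (negb j)) (r (negb j) (S n)) (r j (S n)))) as [F|F].
- rewrite target_ahead by trivial; apply ahead_refl.
- pose proof (deviation_gap j Hj).
  apply (ahead_west_of (a (negb j)) _ (r (negb j) (S n))); trivial; [lra|].
  now apply target_west_of, not_ahead.
Qed.

(** As long as the follower does not approach, it moves to its west, and each
    rotation of the leader lifts the leader in the frame of the follower. *)
Lemma lead_approached (j : bool) (T : nat) : a j <= a (negb j) -> lead j T ->
  exists n, (T <= n)%nat /\ act (negb j) n /\
    ahead (a (negb j)) (r (negb j) n) (r j n).
Proof.
intros Hj L; pose proof (deviation_gap j Hj) as Hgap.
set (f := negb j) in *.
destruct (excluded_middle_informative (exists n, (T <= n)%nat /\ act f n /\
  ahead (a f) (r f n) (r j n))) as [|HN]; trivial; exfalso.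
assert (HF : forall n, (T <= n)%nat -> act f n -> ~ ahead (a f) (r f n) (r j n)).
{ intros n Hn A F; apply HN; now exists n. }
clear HN; destruct (active M f T) as [T1 [HT1 A1]].
assert (Hl : forall n, (T1 <= n)%nat -> lead j n).
{ intros n Hn; apply lead_forever with T; trivial; lia. }
assert (Hw : forall n, (T1 <= n)%nat -> west_of (a f) (r f n) (d f n)).
{ assert (Hact : forall n, (T1 <= n)%nat -> act f n ->
    west_of (a f) (r f n) (d f n)).
  { intros n Hn A; rewrite (aim M _ _ A).
    replace (negb f) with j by (unfold f; now rewrite Bool.negb_involutive).
    apply target_west_of, not_ahead, HF; trivial; lia. }
  induction 1 as [|n Hn IH]; [now apply Hact|].
  destruct (excluded_middle_informative (act f (S n))) as [A|A];
    [apply Hact; trivial; lia|].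
  rewrite (keep M _ _ A).
  destruct (step M f n) as [l [Hl' ->]]; now apply west_of_toward. }
pose proof (ahead_north_lt (a f) (a j) (r f T1) (r j T1) ltac:(lra)
  (proj1 (Hl T1 (le_n T1))) (HF T1 HT1 A1)) as Hg.
set (g := north (a j) (r j T1) - north (a j) (r f T1)).
assert (Hab : a j <> a f).
{ intros E; apply (HF T1 HT1 A1); rewrite <- E; apply (Hl T1 (le_n T1)). }
pose proof (sin_gt_0 (a f - a j) ltac:(lra) ltac:(lra)) as Hs.
(* The follower keeps its height in its own frame and sinks in that of the leader, so the gap [g]
   never shrinks. *)
assert (Hnf : forall n, (T1 <= n)%nat ->
  north (a f) (r f n) = north (a f) (r f T1) /\
  north (a j) (r f n) <= north (a j) (r f T1) /\
  north (a j) (r j n) = north (a j) (r j T1) /\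
  north (a f) (r j T1) <= north (a f) (r j n)).
{ induction 1 as [|n Hn IH]; [lra|].
  destruct (step M f n) as [l [Hl1 ->]].
  destruct (step M j n) as [l' [Hl2 ->]].
  destruct (Hw n Hn) as [m [Hm ->]].
  destruct (Hl n Hn) as [_ [_ [m' [Hm' ->]]]].
  rewrite !toward_west_move, !north_west_move, !Rminus_diag, sin_0.
  rewrite <- (Ropp_minus_distr (a f)), sin_neg.
  assert (0 <= l * m) by nra; assert (0 <= l' * m') by nra; nra. }
(* A leader above the line of the follower stays there, and the next activation of the follower
   would be an approach. *)
assert (Hup : forall n, (T1 <= n)%nat ->
  north (a f) (r j n) <= north (a f) (r f T1)).
{ intros n Hn; destruct (Rle_lt_dec (north (a f) (r j n)) (north (a f) (r f T1)))
    as [|Hlt]; trivial; exfalso.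
  destruct (active M f n) as [u [Hu Au]].
  apply (HF u ltac:(lia) Au); left.
  replace (north (a f) (r f u)) with (north (a f) (r f T1))
    by (symmetry; apply Hnf; lia).
  apply Rlt_le_trans with (1 := Hlt); clear - Hu Hn Hl M Hgap Hs.
  induction Hu as [|u Hu IH]; [lra|].
  destruct (step M j u) as [l [Hl1 ->]].
  destruct (Hl u ltac:(lia)) as [_ [_ [m [Hm ->]]]].
  rewrite toward_west_move, north_west_move.
  assert (0 <= l * m) by nra; nra. }
(* The refusal is assumed at activations of [f], but [target_rotate] needs it at those of [j]. *)
assert (Hnot : forall n, (T1 <= n)%nat -> g <= north (a j) (r j n) - north (a j) (r f n)
  /\ ~ ahead (a f) (r f n) (r j n)).
{ intros n Hn; destruct (Hnf n Hn) as [E1 [E2 [E3 _]]]; unfold g; split; [lra|].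
  specialize (Hup n Hn); intros [F|[F F']]; [lra|].
  destruct (west_of_east_north _ _ _ (eq_sym F) F') as [m [Hm E]].
  apply (f_equal (north (a j))) in E; rewrite north_west_move in E.
  rewrite <- (Ropp_minus_distr (a f)), sin_neg in E; nra. }
destruct (active M j T1) as [T2 [HT2 A2]].
(* A finished rotation is as long as the distance of the robots, at least [g]; an interrupted one
   has length at least [delta]. *)
assert (Hmin : 0 < Rmin delta g) by (apply Rmin_glb_lt; unfold g; lra).
apply (no_endless_descent (act j) (fun n => - north (a f) (r j n))
  (- north (a f) (r f T1)) (Rmin delta g * sin (a f - a j)) T2); trivial.
- now apply Rmult_lt_0_compat.
- intros t Ht _; specialize (Hup t ltac:(lia)); lra.
- intros t Ht A.
  destruct (round M j t A) as [t' [l [Ht' [A' [Hl' [E D]]]]]].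
  exists t'; repeat split; trivial.
  destruct (Hnot t ltac:(lia)) as [Hgt Hn].
  rewrite (aim M _ _ A) in E; fold f in E.
  rewrite (target_rotate phi (a f)) in E; trivial; [|apply Hl; lia].
  rewrite toward_west_move in E.
  set (m := dist (r j t) (r f t)) in *.
  pose proof (dist_nonneg (r j t) (r f t)) as Hm; fold m in Hm.
  assert (Hlm : Rmin delta g <= l * m).
  { destruct D as [->|D].
    - apply Rle_trans with (1 := Rmin_r _ _); rewrite Rmult_1_l.
      apply Rle_trans with (1 := Hgt); unfold m.
      apply Rle_trans with (2 := north_le_dist (a j) _ _).
      rewrite Rabs_minus_sym; apply Rle_abs.
    - apply Rle_trans with (1 := Rmin_l _ _).
      rewrite E, dist_west_move in D by nra; trivial. }
  rewrite E, north_west_move; nra.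
Qed.

(** After its first approach the follower only visits points behind the leader in its own order, and
    the leader keeps moving ahead in that order. *)
Lemma lead_gathers (j : bool) (T : nat) : a j <= a (negb j) -> lead j T ->
  gathers r.
Proof.
intros Hj L; pose proof (deviation_gap j Hj).
destruct (lead_approached j T Hj L) as [t [Ht [A F]]].
apply follow with j t; [now apply lead_forever with T|].
intros n Hn _; cut (ahead (a (negb j)) (r (negb j) n) (r j n) /\
  ahead (a (negb j)) (d (negb j) n) (r j n)); [tauto|].
induction Hn as [|n Hn [IH IH']].
- rewrite (aim M _ _ A), Bool.negb_involutive, target_ahead by trivial.
  split; trivial; apply ahead_refl.
- assert (H1 : ahead (a (negb j)) (r j n) (r j (S n))).
  { destruct (lead_forever j T n Hj L ltac:(lia)) as [_ [_ Hw]].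
    destruct (step M j n) as [l [Hl ->]].
    apply (west_of_ahead _ (a j)); [lra | now apply west_of_toward]. }
  assert (H2 : ahead (a (negb j)) (r (negb j) (S n)) (r j (S n))).
  { apply ahead_trans with (r j n); trivial.
    destruct (step M (negb j) n) as [l [Hl ->]].
    now apply toward_ahead. }
  split; trivial.
  destruct (excluded_middle_informative (act (negb j) (S n))) as [A'|A'].
  + rewrite (aim M _ _ A'), Bool.negb_involutive, target_ahead
      by trivial; apply ahead_refl.
  + rewrite (keep M _ _ A'); now apply ahead_trans with (r j n).
Qed.

(** The first time that its follower declines to approach, the follower itself
    becomes a leader, with the smaller deviation. *)
Lemma lead_larger_gathers (j : bool) (T : nat) : a j <= a (negb j) ->
  lead (negb j) T -> gathers r.
Proof.
intros Hj L; pose proof (deviation_gap j Hj); set (f := negb j) in *.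
assert (Ef : negb f = j) by apply Bool.negb_involutive.
set (P := fun n => act j n /\ ~ ahead (a j) (r j n) (r f n)).
destruct (excluded_middle_informative (exists n, (T <= n)%nat /\ P n))
  as [[n0 [Hn0 HP0]]|HN].
- destruct (nat_first P T n0 Hn0 HP0) as [n [Hn [[A HP] Hfirst]]].
  (* The refusal at [n] gives [j] a new destination, so only the parts of leadership that do not
     mention it are carried over to [n]. *)
  assert (Hm : ahead (a f) (r j n) (r f n) /\ west_of (a f) (r f n) (d f n)).
  { destruct (Nat.eq_dec n T) as [->|HnT];
      [destruct L as [L1 [_ L2]]; rewrite Ef in L1; tauto|].
    destruct n as [|n]; [lia|].
    assert (L' : lead f n).
    { apply lead_following with T; trivial; [|lia]; rewrite Ef.
      intros m Hm Am.
      destruct (excluded_middle_informative (ahead (a j) (r j m) (r f m)));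
        trivial; exfalso; apply (Hfirst m); [lia | now split]. }
    destruct (lead_move f n L') as [H1 [_ H2]]; rewrite Ef in H1; split; trivial.
    apply west_of_update; trivial; now rewrite Ef. }
  destruct Hm as [Hm1 Hm2].
  assert (Hne : ~ ahead (a f) (r f n) (r j n)).
  { intros E; apply HP; rewrite (ahead_antisym (a f) (r f n) (r j n)) by trivial.
    apply ahead_refl. }
  apply lead_gathers with j n; trivial; fold f.
  apply not_ahead in HP; split; [|split]; trivial.
  + apply (ahead_west_of (a f) _ (r f n)); trivial; lra.
  + rewrite (aim M _ _ A); now apply target_west_of.
- apply follow with f T; trivial; rewrite Ef; intros n Hn A.
  destruct (excluded_middle_informative (ahead (a j) (r j n) (r f n)));
    trivial; exfalso; apply HN; now exists n.
Qed.

(** * Both robots approach *)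

(** The parameters are not confined to [[0, 1]]: what counts is the common line and that the robot
    does not turn back. *)
Definition headed (i : bool) (p q : point) (n : nat) : Prop :=
  exists s s', r i n = toward p q s /\ d i n = toward p q s' /\ s <= s'.

Lemma headed_move (i : bool) (p q : point) (n : nat) : headed i p q n ->
  exists s s', r i (S n) = toward p q s /\ d i n = toward p q s' /\ s <= s'.
Proof.
intros [s [s' [E [E' Hs]]]].
destruct (step M i n) as [l [Hl El]].
exists (s + l * (s' - s)), s'; repeat split; trivial.
- rewrite El, E, E'; apply toward_toward.
- nra.
Qed.

(** On the line of [p] and [q] the compass order is the order of parameters, so an approaching robot
    always aims further in its initial direction. *)
Lemma both_headed (f : bool) (n : nat) :
  let j := negb f in let p := r f 0%nat in let q := r j 0%nat in
  p <> q -> ahead (a f) p q -> ahead (a j) q p ->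
  (forall i m, (m <= n)%nat -> act i m -> ahead (a i) (r i m) (r (negb i) m)) ->
  headed f p q n /\ headed j q p n.
Proof.
intros j p q Hpq Hf Hj HA.
assert (Ej : negb j = f) by apply Bool.negb_involutive.
assert (Haim : forall i m, (m <= n)%nat -> act i m -> d i m = r (negb i) m).
{ intros i m Hm A; rewrite (aim M _ _ A).
  apply target_ahead, HA; trivial. }
cut (forall m, (m <= n)%nat -> headed f p q m /\ headed j q p m); [auto|].
assert (Hpend : forall i x y m, (S m <= n)%nat -> x <> y -> ahead (a i) x y ->
  headed i x y m -> headed (negb i) y x m -> headed i x y (S m)).
{ intros i x y m Hm Hxy Hi H1 H2.
  destruct (headed_move _ _ _ _ H1) as [s [s' [E1 [E2 Hs]]]].
  destruct (headed_move _ _ _ _ H2) as [u [u' [E3 [E4 Hu]]]].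
  destruct (excluded_middle_informative (act i (S m))) as [A|A].
  - rewrite toward_rev in E3; exists s, (1 - u).
    rewrite Haim by trivial; repeat split; trivial.
    apply (ahead_toward_inv (a i) x y); trivial; rewrite <- E1, <- E3.
    now apply HA.
  - exists s, s'; rewrite (keep M _ _ A); tauto. }
induction m as [|m IH]; intros Hm.
- split.
  + destruct (excluded_middle_informative (act f 0%nat)) as [A|A].
    * exists 0, 1; rewrite Haim, toward_0, toward_1 by trivial.
      repeat split; trivial; lra.
    * exists 0, 0; rewrite (idle M _ A), toward_0.
      repeat split; trivial; lra.
  + destruct (excluded_middle_informative (act j 0%nat)) as [A|A].
    * exists 0, 1; rewrite Haim, toward_0, toward_1 by trivial.
      rewrite Ej; repeat split; trivial; lra.
    * exists 0, 0; rewrite (idle M _ A), toward_0.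
      repeat split; trivial; lra.
- destruct (IH ltac:(lia)) as [H1 H2]; split.
  + now apply Hpend.
  + apply Hpend; rewrite ?Ej; auto.
Qed.

(** Robots that never pass each other stay at the place where they first meet. *)
Lemma always_approaching_gathers (f : bool) :
  let j := negb f in
  r f 0%nat <> r j 0%nat ->
  (forall i, ahead (a i) (r i 0%nat) (r (negb i) 0%nat)) ->
  (forall i m, act i m -> ahead (a i) (r i m) (r (negb i) m)) -> gathers r.
Proof.
intros j Hpq H0 HA; set (p := r f 0%nat) in *; set (q := r j 0%nat) in *.
assert (Hf : ahead (a f) p q) by apply H0.
assert (Hj : ahead (a j) q p).
{ pose proof (H0 j) as Hj; unfold j at 3 in Hj; now rewrite Bool.negb_involutive in Hj. }
assert (HH : forall n, headed f p q n /\ headed j q p n).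
{ intros n; apply both_headed; auto. }
assert (Hrf : forall n m, (n <= m)%nat -> ahead (a f) (r f n) (r f m)).
{ induction 1 as [|m Hm IH]; [apply ahead_refl|].
  apply ahead_trans with (1 := IH).
  destruct (step M f m) as [l [Hl ->]].
  apply ahead_toward; trivial; [apply ahead_refl|].
  destruct (HH m) as [[s [s' [-> [-> Hs]]]] _]; now apply ahead_toward_toward. }
assert (Hrj : forall n m, (n <= m)%nat -> ahead (a f) (r j m) (r j n)).
{ induction 1 as [|m Hm IH]; [apply ahead_refl|].
  apply ahead_trans with (2 := IH).
  destruct (step M j m) as [l [Hl ->]].
  apply toward_ahead; trivial; [apply ahead_refl|].
  destruct (HH m) as [_ [s [s' [-> [-> Hs]]]]].
  now apply ahead_toward_rev. }
(* The order at the next activation of [f] carries back to [n], because both robots only move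
   towards each other's side. *)
assert (Hfj : forall n, ahead (a f) (r f n) (r j n)).
{ intros n; destruct (active M f n) as [t [Ht A]].
  apply ahead_trans with (r f t); [now apply Hrf|].
  apply ahead_trans with (r j t); [now apply HA | now apply Hrj]. }
destruct (excluded_middle_informative (exists t, r f t = r j t)) as [[t Et]|HN].
- exists (r f t), t; intros i n Hn.
  assert (E1 : r f n = r f t).
  { apply (ahead_antisym (a f)); [|now apply Hrf].
    rewrite Et; apply ahead_trans with (r j n); auto. }
  assert (E2 : r j n = r j t).
  { apply (ahead_antisym (a f)); [now apply Hrj|].
    rewrite <- Et; apply ahead_trans with (r f n); auto. }
  destruct (Bool.bool_dec i f) as [->|Hi]; trivial.
  replace i with j by (unfold j; destruct i, f; easy); now rewrite E2.
- exfalso; destruct (active M f 0%nat) as [T [_ AT]].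
  set (D := dist p q).
  assert (HD : 0 < D).
  { unfold D, dist; apply norm_pos; intros E; injection E as E1 E2; apply Hpq.
    rewrite (surjective_pairing p), (surjective_pairing q); f_equal; lra. }
  assert (Hs1 : forall n s, r f n = toward p q s -> s <= 1).
  { intros n s E; apply (ahead_toward_inv (a f) p q); trivial.
    rewrite <- E, toward_1; apply ahead_trans with (1 := Hfj n).
    apply Hrj; lia. }
  (* With [r f n = toward p q s], the measure is [(1 - s) * D]. *)
  apply (no_endless_descent (act f) (fun n => dist (r f n) q) 0 delta T); trivial.
  + intros; apply dist_nonneg.
  + intros t _ A; destruct (round M f t A)
      as [t' [l [Ht' [A' [Hl [E Hd]]]]]].
    exists t'; repeat split; trivial.
    destruct Hd as [->|Hd].
    (* The move ends at [r j t], while [r j t'] lies between that point and [r f t']. *)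
    * exfalso; apply HN; exists t'.
      rewrite (aim M _ _ A), target_ahead, toward_1 in E by auto.
      apply (ahead_antisym (a f)); auto; rewrite E; auto.
    * destruct (HH t) as [[s [s' [E1 [E2 Hs]]]] _].
      rewrite E2, E1, toward_toward in E.
      pose proof (Hs1 _ _ E1); pose proof (Hs1 _ _ E).
      rewrite E, E1, dist_toward in Hd.
      rewrite E, E1; rewrite <- (toward_1 p q) at 2 4; rewrite !dist_toward.
      rewrite (Rabs_right (s + _ - s)) in Hd by nra.
      rewrite !Rabs_right by lra; fold D in Hd |- *; nra.
Qed.

(** At the first refusal the robots have passed each other on their line, and the refusing robot
    leads. *)
Lemma both_approach_gathers (j : bool) : a j <= a (negb j) ->
  r (negb j) 0%nat <> r j 0%nat ->
  (forall i, ahead (a i) (r i 0%nat) (r (negb i) 0%nat)) -> gathers r.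
Proof.
intros Hj Hpq H0; pose proof (deviation_gap j Hj).
set (f := negb j) in *; assert (Ef : negb f = j) by apply Bool.negb_involutive.
set (p := r f 0%nat) in *; set (q := r j 0%nat) in *.
assert (H0f : ahead (a f) p q) by (unfold q; rewrite <- Ef; apply H0).
assert (H0j : ahead (a j) q p) by apply H0.
set (Q := fun i n => act i n /\ ~ ahead (a i) (r i n) (r (negb i) n)).
assert (HQ : forall i n, ~ Q i n -> act i n -> ahead (a i) (r i n) (r (negb i) n)).
{ intros i n Hn A; destruct (excluded_middle_informative
    (ahead (a i) (r i n) (r (negb i) n))); trivial; exfalso; now apply Hn. }
destruct (excluded_middle_informative (exists n, exists i, Q i n)) as [[n0 Hn0]|HN].
2: { apply (always_approaching_gathers f); rewrite ?Ef; trivial.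
  intros i m; apply HQ; intros Hm; apply HN; now exists m, i. }
destruct (nat_first (fun n => exists i, Q i n) 0 n0 ltac:(lia) Hn0)
  as [n [_ [HQn Hfirst]]].
destruct n as [|m]; [exfalso; destruct HQn as [i [_ Hi]]; now apply Hi|].
assert (HH : headed f p q m /\ headed j q p m).
{ pose proof (both_headed f m) as HH; rewrite Ef in HH; apply HH; trivial.
  intros i k Hk; apply HQ; intros Hi; apply (Hfirst k); [lia | now exists i]. }
destruct HH as [Hhf Hhj].
destruct (headed_move _ _ _ _ Hhf) as [sf [df [Esf [Edf Hsf]]]].
destruct (headed_move _ _ _ _ Hhj) as [sj [dj [Esj [Edj Hsj]]]].
rewrite toward_rev in Esj, Edj.
set (n := S m) in *.
(* If both refuse, [j] is taken as leader; in the other case an activated [j] is known to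
   approach. *)
destruct (excluded_middle_informative (Q j n)) as [[A Hn]|Hn].
- fold f in Hn; apply lead_gathers with j n; trivial.
  assert (Hlt : 1 - sj < sf).
  { destruct (Rle_lt_dec sf (1 - sj)); trivial; exfalso; apply Hn.
    rewrite Esf, Esj; now apply ahead_toward_rev. }
  apply not_ahead in Hn as Hn'; split; [|split]; trivial; fold f.
  + destruct (excluded_middle_informative (act f n)) as [Af|Af].
    * rewrite (aim M _ _ Af), Ef.
      destruct (excluded_middle_informative (ahead (a f) (r f n) (r j n))) as [F|F].
      -- rewrite target_ahead by trivial; apply ahead_refl.
      -- apply (ahead_west_of (a f) _ (r f n)); trivial; [lra|].
         now apply target_west_of, not_ahead.
    * rewrite (keep M f m Af : d f n = d f m), Edf, Esj.
      apply ahead_toward_rev; trivial; lra.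
  + rewrite (aim M _ _ A); now apply target_west_of.
- assert (HQf : Q f n).
  { destruct HQn as [i Hi]; destruct (Bool.bool_dec i j) as [->|Hij]; [easy|].
    replace f with i by (unfold f; destruct i, j; easy); trivial. }
  destruct HQf as [A HF]; rewrite Ef in HF.
  apply lead_larger_gathers with j n; trivial; fold f.
  assert (Hlt : 1 - sj < sf).
  { destruct (Rle_lt_dec sf (1 - sj)); trivial; exfalso; apply HF.
    rewrite Esf, Esj; now apply ahead_toward_toward. }
  apply not_ahead in HF as HF'; split; [|split]; rewrite ?Ef; trivial.
  + destruct (excluded_middle_informative (act j n)) as [Aj|Aj].
    * rewrite (aim M _ _ Aj), target_ahead by (now apply HQ).
      apply ahead_refl.
    * rewrite (keep M j m Aj : d j n = d j m), Edj, Esf.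
      apply ahead_toward_toward; trivial; lra.
  + rewrite (aim M _ _ A), Ef; now apply target_west_of.
Qed.

(** * The initial configuration *)

Lemma motion_gathers : gathers r.
Proof.
assert (exists j, a j <= a (negb j)) as [j Hj].
{ destruct (Rle_lt_dec (a true) (a false)); [exists true | exists false]; simpl; lra. }
pose proof (deviation_gap j Hj); set (f := negb j) in *.
assert (Ef : negb f = j) by apply Bool.negb_involutive.
assert (Hw : forall i, ahead (a i) (r (negb i) 0%nat) (r i 0%nat) ->
  west_of (a i) (r i 0%nat) (d i 0%nat)).
{ intros i Hi; destruct (excluded_middle_informative (act i 0%nat)) as [A|A].
  - rewrite (aim M _ _ A); now apply target_west_of.
  - rewrite (idle M _ A); apply west_of_refl. }
(* Either [j] leads at once, or it lags; then [f] lags too and both approach, or [f] leads. *)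
destruct (excluded_middle_informative (ahead (a j) (r f 0%nat) (r j 0%nat)))
  as [H1|H1].
- apply lead_gathers with j 0%nat; trivial; split; [|split]; auto; fold f.
  destruct (excluded_middle_informative (ahead (a f) (r f 0%nat) (r j 0%nat)))
    as [H2|H2].
  + destruct (excluded_middle_informative (act f 0%nat)) as [A|A].
    * rewrite (aim M _ _ A), Ef, target_ahead by trivial.
      apply ahead_refl.
    * now rewrite (idle M _ A).
  + apply (ahead_west_of (a f) _ (r f 0%nat)); trivial; [lra|].
    apply Hw; rewrite Ef; now apply not_ahead.
- apply not_ahead in H1 as H1'.
  destruct (excluded_middle_informative (ahead (a f) (r f 0%nat) (r j 0%nat)))
    as [H2|H2].
  + apply both_approach_gathers with j; trivial.
    * fold f; intros E; apply H1; rewrite E; apply ahead_refl.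
    * intros i; destruct (Bool.bool_dec i j) as [->|Hi]; trivial.
      replace i with f by (unfold f; destruct i, j; easy); now rewrite Ef.
  + apply not_ahead in H2.
    apply lead_larger_gathers with j 0%nat; trivial; fold f.
    split; [|split]; rewrite ?Ef; trivial; [|apply Hw; now rewrite Ef].
    destruct (excluded_middle_informative (act j 0%nat)) as [A|A].
    * rewrite (aim M _ _ A), target_ahead by trivial; apply ahead_refl.
    * now rewrite (idle M _ A).
Qed.

End Motion.

(** * From executions to motions *)

(** The default before the first activation is the initial position, so that an idle robot counts as
    moving to where it is. *)
Fixpoint pending (phi : R) (a : bool -> R) (e : run) (i : bool) (n : nat) : point :=
  if excluded_middle_informative (activated e i n)
  then target phi (a i) (position e i n) (position e (negb i) n)
  else match n with
       | O => position e i 0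
       | S m => pending phi a e i m
       end.

Lemma next_activation (e : run) (i : bool) (t : nat) :
  (forall n, exists u, (n <= u)%nat /\ activated e i u) ->
  activated e i t -> exists t', consecutive_activations e i t t'.
Proof.
intros Hfair A; destruct (Hfair (S t)) as [u [Hu Au]].
destruct (nat_first (activated e i) (S t) u Hu Au) as [t' [Ht' [A' Hm]]].
exists t'; repeat split; trivial; intros m Hlt; apply Hm; lia.
Qed.

Lemma last_activation (e : run) (i : bool) (n : nat) :
  (forall t, (t <= n)%nat -> ~ activated e i t) \/
  exists t, (t <= n)%nat /\ activated e i t /\
    forall u, (t < u <= n)%nat -> ~ activated e i u.
Proof.
induction n as [|n IH].
- destruct (excluded_middle_informative (activated e i 0%nat)) as [A|A].
  + right; exists 0%nat; repeat split; trivial; lia.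
  + left; intros t Ht; now replace t with 0%nat by lia.
- destruct (excluded_middle_informative (activated e i (S n))) as [A|A].
  + right; exists (S n); repeat split; trivial; lia.
  + destruct IH as [IH|[t [Ht [At IH]]]].
    * left; intros t Ht; destruct (Nat.eq_dec t (S n)) as [->|]; trivial.
      apply IH; lia.
    * right; exists t; repeat split; trivial; [lia|].
      intros u Hu; destruct (Nat.eq_dec u (S n)) as [->|]; trivial.
      apply IH; lia.
Qed.

Section Execution.

Context (phi delta : R) (Hphi : 0 <= phi < PI / 2) (a : bool -> R) (e : run).
Context (He : execution (A_SS phi) delta e).
Context (Ha : forall i t, deviation e i t = a i).

Lemma pending_activated (i : bool) (n : nat) : activated e i n ->
  pending phi a e i n =
  target phi (a i) (position e i n) (position e (negb i) n).
Proof. intros A; destruct n; simpl; now destruct excluded_middle_informative. Qed.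

Lemma pending_keep (i : bool) (n : nat) : ~ activated e i (S n) ->
  pending phi a e i (S n) = pending phi a e i n.
Proof. intros A; simpl; now destruct excluded_middle_informative. Qed.

Lemma pending_since (i : bool) (t n : nat) : (t <= n)%nat ->
  (forall u, (t < u <= n)%nat -> ~ activated e i u) ->
  pending phi a e i n = pending phi a e i t.
Proof.
intros Hn; induction Hn as [|n Hn IH]; trivial; intros Hu.
rewrite pending_keep by (apply Hu; lia); apply IH; intros u Hu'; apply Hu; lia.
Qed.

Lemma pending_idle (i : bool) (n : nat) :
  (forall t, (t <= n)%nat -> ~ activated e i t) ->
  pending phi a e i n = position e i 0 /\
  position e i n = position e i 0 /\ position e i (S n) = position e i 0.
Proof.
intros Hn.
assert (Hp : forall m, (m <= S n)%nat -> position e i m = position e i 0).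
{ intros m Hm; apply (initially_idle _ _ _ He); [apply pos_INR|].
  intros t A; apply le_INR; destruct (Nat.le_gt_cases t n) as [L|L]; [|lia].
  exfalso; now apply (Hn t). }
repeat split; try (apply Hp; lia).
rewrite pending_since with (t := 0%nat); [|lia|intros u Hu; apply Hn; lia].
simpl; destruct excluded_middle_informative as [A|_]; trivial.
exfalso; apply (Hn 0%nat); trivial; lia.
Qed.

Lemma cycle_pending (i : bool) (t t' : nat) : consecutive_activations e i t t' ->
  moves_toward e i t t' (pending phi a e i t) /\
  (position e i t' = pending phi a e i t
   \/ delta <= dist (position e i t) (position e i t')).
Proof.
intros C; destruct (cycle _ _ _ He i t t' C) as [q [Eq H]].
destruct C as [_ [A _]]; rewrite pending_activated by trivial.
unfold frame in Eq; rewrite Ha in Eq.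
apply A_SS_global in Eq; [now rewrite <- Eq | trivial | apply (scale_pos _ _ _ He)].
Qed.

Lemma execution_motion :
  motion phi delta a (activated e) (position e) (pending phi a e).
Proof.
split.
- intros i A; simpl; now destruct excluded_middle_informative.
- intros i n; destruct (last_activation e i n) as [Hn|[t [Ht [A Hu]]]].
  + destruct (pending_idle i n Hn) as [-> [-> ->]].
    exists 0; rewrite toward_0; split; [lra | reflexivity].
  + destruct (next_activation e i t (fair _ _ _ He i) A) as [t' C].
    destruct (cycle_pending i t t' C) as [[l [_ [_ [Hmono Hl]]]] _].
    destruct C as [Htt' [_ [A' _]]].
    assert (Hnt' : (S n <= t')%nat).
    { destruct (Nat.le_gt_cases t' n) as [L|L]; [exfalso; apply (Hu t'); trivial|]; lia. }
    rewrite (pending_since i t n) by trivial.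
    apply le_INR in Ht, Hnt'; pose proof (le_INR n (S n) ltac:(lia)).
    destruct (Hl (INR n) ltac:(lra)) as [H1 E1].
    destruct (Hl (INR (S n)) ltac:(lra)) as [H2 E2].
    pose proof (Hmono (INR n) (INR (S n)) ltac:(lra)) as H3.
    fold (position e i n) in E1; fold (position e i (S n)) in E2.
    rewrite E1, E2; set (q := pending phi a e i t); set (p := position e i t).
    set (u := l (INR n)) in *; set (u' := l (INR (S n))) in *.
    (* The fraction is rescaled to the way remaining at time [n]; nothing remains when [u = 1]. *)
    destruct (Req_dec u 1) as [Eu|Eu].
    * exists 0; rewrite toward_0; split; [lra|]; f_equal; lra.
    * exists ((u' - u) / (1 - u)); split.
      -- split.
         ++ apply Rmult_le_pos; [lra|]; apply Rlt_le, Rinv_0_lt_compat; lra.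
         ++ apply Rmult_le_reg_r with (1 - u); [lra|].
            unfold Rdiv; rewrite Rmult_assoc, Rinv_l; lra.
      -- rewrite <- (toward_1 p q) at 3; rewrite toward_toward; f_equal.
         field; lra.
- intros i n A; now apply pending_activated.
- intros i n A; now apply pending_keep.
- intros i n; apply (fair _ _ _ He).
- intros i t A; destruct (next_activation e i t (fair _ _ _ He i) A) as [t' C].
  destruct (cycle_pending i t t' C) as [[l [_ [_ [_ Hl]]]] D].
  destruct C as [Htt' [_ [A' _]]].
  pose proof (lt_INR t t' Htt').
  destruct (Hl (INR t') ltac:(lra)) as [H1 E1]; fold (position e i t') in E1.
  (* If start and destination coincide, [l] need not be 1 on arrival, so the fraction 1 is given
     explicitly. *)
  destruct D as [D|D].
  + exists t', 1; rewrite toward_1; split; [lia|].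
    split; [|split; [lra | split; [|left]]]; trivial.
  + exists t', (l (INR t')); split; [lia|].
    split; [|split; [|split; [|right]]]; trivial.
Qed.

End Execution.

Theorem theorem5 :
  forall phi delta : R,
    0 <= phi < PI / 2 -> 0 < delta ->
    gathering_algorithm_static phi delta (A_SS phi).
Proof.
intros phi delta Hphi Hdelta _ e He [Hcomp [a Ha]] _.
pose proof (execution_motion phi delta Hphi a e He Ha) as M.
assert (Hdev : forall i, Rabs (a i) <= phi).
{ intros i; rewrite <- (Ha i 0%nat); apply Hcomp. }
destruct (motion_gathers phi delta Hphi Hdelta a Hdev _ _ _ M) as [p [k Hk]].
exists p, k; intros t Ht; unfold config; now rewrite !Hk.
Qed.
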